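(* Assume the following. (1) For every $\alpha>0$, $\langle \nu, e^{\alpha\phi}\rangle<\infty$, and $\mathcal{I}$ is lower semi-continuous on $\mathcal{P}_\phi(E)$. (2) For every $t\in\mathcal{T}$, $\Psi_t$ is lower semi-continuous on $\mathcal{P}_\phi(E)$. (3) The function $\mu\mapsto \sup_{t\in\mathcal{T}}\Psi_t(\mu)$ is well-defined and continuous on $\mathcal{P}_\phi(E)$. (4) For any $\mu\in\mathcal{D}_{\mathcal{I}}\cap\mathcal{A}_\Psi$ there exists $\tilde\mu\in\mathcal{D}_{\mathcal{I}}$ such that: (i) for every $\varepsilon>0$ small enough, $\Psi_t(\mu+\varepsilon(\tilde\mu-\mu))<0$ for all $t\in\mathcal{T}$; (ii) $\limsup_{\varepsilon\to0}\mathcal{F}(\mu+\varepsilon(\tilde\mu-\mu))\le\mathcal{F}(\mu)$. (5) $\overline{\mathcal{I}}_\Psi:=\inf_{\mu\in\mathcal{D}_{\mathcal{I}}\cap\mathcal{A}_\Psi}\mathcal{I}(\mu)<+\infty$. Let $(\Pi^N)_{N\ge1}$ be a sequence of probability measures on $\mathcal{P}_\phi(E)$ which satisfies a large deviation principle (at speed $N$) with rate function $\mathcal{I}$, and such that $\Pi^N(\mathcal{A}_\Psi)>0$ for every $N\ge1$. Then the sequence of conditional distributions $(\Pi^N(\cdot\,|\,\mathcal{A}_\Psi))_{N\ge1}$ satisfies a large deviation principle on $\mathcal{P}_\phi(E)$ (at speed $N$) with rate function $\mathcal{I}_\Psi:\mathcal{P}_\phi(E)\to[0,+\infty]$ defined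 by $$\mathcal{I}_\Psi(\mu):=\begin{cases}\mathcal{I}(\mu)-\overline{\mathcal{I}}_\Psi & \text{if }\mu\in\mathcal{A}_\Psi,\\ +\infty&\text{otherwise.}\end{cases}$$
   Context: $E$ is a complete separable metric space with its Borel $\sigma$-algebra, $\mathcal{P}(E)$ the set of Borel probability measures on $E$, and $\langle\mu,f\rangle:=\int_E f\,d\mu$. Fix a continuous $\phi:E\to[0,\infty)$ and a reference measure $\nu\in\mathcal{P}(E)$. Set $\mathcal{P}_\phi(E):=\{\mu\in\mathcal{P}(E):\langle\mu,\phi\rangle<\infty\}$, endowed with the (metrizable) topology in which $\mu_k\to\mu$ iff $\langle\mu_k,\phi\rangle\to\langle\mu,\phi\rangle$ and $\langle\mu_k,f\rangle\to\langle\mu,f\rangle$ for every bounded continuous $f:E\to\mathbb{R}$, and with its Borel $\sigma$-algebra. $H(\mu|\nu):=\int_E\log\frac{d\mu}{d\nu}\,d\mu$ if $\mu\ll\nu$ and $+\infty$ otherwise. $\mathcal{F}:\mathcal{P}_\phi(E)\to(-\infty,+\infty]$ is measurable, $\mathcal{I}(\mu):=H(\mu|\nu)+\mathcal{F}(\mu)$ for $\mu\in\mathcal{P}_\phi(E)$, and $\mathcal{D}_{\mathcal{I}}:=\{\mu\in\mathcal{P}_\phi(E):H(\mu|\nu)<+\infty,\ \mathcal{F}(\mu)<+\infty\}$. $\mathcal{T}$ is a compact metric space, $(\Psi_t)_{t\in\mathcal{T}}$ is a family of functions $\mathcal{P}_\phi(E)\to\mathbb{R}$, and $\mathcal{A}_\Psi:=\{\mu\in\mathcal{P}_\phi(E):\forall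 t\in\mathcal{T},\ \Psi_t(\mu)\le0\}$. A sequence $(\Pi^N)$ of probability measures satisfies the large deviation principle with (lower semi-continuous) rate function $J$ if $\limsup_N N^{-1}\log\Pi^N(C)\le-\inf_C J$ for every closed $C$ and $\liminf_N N^{-1}\log\Pi^N(U)\ge-\inf_U J$ for every open $U$. $\Pi^N(\cdot|A):=\Pi^N(\cdot\cap A)/\Pi^N(A)$.
   Formalization: Added assumption: for every μ, t ↦ Ψ_t(μ) is upper semi-continuous on the compact space T; without it, Ψ_t(μ_ε)<0 for all t need not give sup_t Ψ_t(μ_ε)<0, and the statement fails. *)

(* Defs.v *)
From HB Require Import structures.
From mathcomp Require Import all_boot all_order all_algebra.
From mathcomp Require Import all_classical all_reals all_analysis.
From mathcomp Require Import measurable_realfun.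

Set Implicit Arguments.
Unset Strict Implicit.
Unset Printing Implicit Defensive.

Import Order.TTheory GRing.Theory Num.Theory.
Import numFieldNormedType.Exports.

Local Open Scope classical_set_scope.
Local Open Scope ring_scope.

(* The library's measurable types are pointed, hence so is a complete metric
   space here; nothing is lost for a space that carries a probability. *)
#[short(type="completeMetricType")]
HB.structure Definition CompleteMetric (R : numDomainType) :=
  {T of CompletePseudoMetric R T & Metric R T}.

Definition separable (X : topologicalType) : Prop :=
  exists2 D : set X, countable D & dense D.

Notation borel X := (g_sigma_algebraType (@open X)).

Lemma borel_continuous_measurable (R : realType) (X : ptopologicalType)
    (f : X -> R) :
  continuous f -> measurable_fun setT (f : borel X -> R).
Proof.
move=> /continuousP cf; apply: (measurability _ (RGenOpens.measurableE R)).
move=> _ [_ [a [b ->] <-]]; rewrite setTI; apply: sub_sigma_algebra.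
exact/cf/interval_open.
Qed.

Record weight (R : realType) (E : completeMetricType R) := Weight {
  weight_fun :> E -> R ;
  weight_continuous : continuous weight_fun ;
  weight_ge0 : forall x, 0 <= weight_fun x }.

Section Pphi.
Context {R : realType} {E : completeMetricType R}.
Implicit Types phi : weight E.

Definition finite_moment phi : Type :=
  {mu : probability (borel E) R | (\int[mu]_x (phi x)%:E < +oo)%E}.

Definition phi_test phi : Type :=
  {f : E -> R | f = phi \/ (continuous f /\ exists M, forall x, `|f x| <= M)}.

(* <mu, f>, for f integrable. *)
Definition pairing phi (mu : finite_moment phi) (f : E -> R) : R :=
  fine (\int[proj1_sig mu]_x (f x)%:E)%E.

HB.instance Definition _ phi := Choice.on (finite_moment phi).

(* Coarsest topology making mu |-> <mu, phi> and mu |-> <mu, f>, f bounded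
   continuous, continuous; see [cvg_Pphi] for its convergence. *)
Definition Pphi phi : Type :=
  sup_topology (fun g : phi_test phi => Topological.class
    (initial_topology (fun mu : finite_moment phi => pairing mu (proj1_sig g)))).

HB.instance Definition _ phi := Topological.on (Pphi phi).

Definition law phi (mu : Pphi phi) : probability (borel E) R := proj1_sig mu.

Definition mkPphi phi (mu : probability (borel E) R)
    (h : (\int[mu]_x (phi x)%:E < +oo)%E) : Pphi phi :=
  exist _ mu h.

Lemma measurable_weight phi :
  measurable_fun setT (fun x : borel E => (phi x)%:E).
Proof.
have mphi : measurable_fun setT (phi : borel E -> R).
  by apply: borel_continuous_measurable; exact: weight_continuous.
exact/measurable_EFinP.
Qed.

Lemma dirac_moment phi : (\int[@dirac _ (borel E) point R]_x (phi x)%:E < +oo)%E.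
Proof.
rewrite integral_dirac//; last exact: measurable_weight.
by rewrite diracT mul1e ltry.
Qed.

HB.instance Definition _ phi :=
  isPointed.Build (Pphi phi) (mkPphi (dirac_moment phi)).

Definition clamp (e : R) : R := Num.max 0 (Num.min e 1).

Lemma clamp_ge0 e : 0 <= clamp e.
Proof. by rewrite /clamp le_max lexx. Qed.

Lemma onem_clamp_ge0 e : 0 <= 1 - clamp e.
Proof. by rewrite subr_ge0 /clamp ge_max ler01 ge_min lexx orbT. Qed.

Definition mix_measure (e : R) (mu mu' : probability (borel E) R)
    : set (borel E) -> \bar R :=
  measure_add (mscale (NngNum (onem_clamp_ge0 e)) mu)
              (mscale (NngNum (clamp_ge0 e)) mu').

HB.instance Definition _ e mu mu' := Measure.on (mix_measure e mu mu').

Lemma mix_measureE e mu mu' A :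
  mix_measure e mu mu' A =
  ((1 - clamp e)%:E * mu A + (clamp e)%:E * mu' A)%E.
Proof. by rewrite /mix_measure measure_addE. Qed.

Lemma mix_measure_setT e mu mu' : mix_measure e mu mu' setT = 1%E.
Proof.
by rewrite mix_measureE !probability_setT !mule1 -EFinD subrK.
Qed.

HB.instance Definition _ e mu mu' :=
  Measure_isProbability.Build _ _ _ (mix_measure e mu mu')
    (mix_measure_setT e mu mu').

Lemma mix_moment phi e (mu mu' : Pphi phi) :
  (\int[mix_measure e (law mu) (law mu')]_x (phi x)%:E < +oo)%E.
Proof.
have phi0 x : (0 <= (phi x)%:E)%E by rewrite lee_fin weight_ge0.
rewrite /mix_measure ge0_integral_measure_add//; last exact: measurable_weight.
rewrite !ge0_integral_mscale//; try exact: measurable_weight.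
rewrite lte_add_pinfty// lte_mul_pinfty// ?lee_fin ?onem_clamp_ge0 ?clamp_ge0//.
  exact: (proj2_sig mu).
exact: (proj2_sig mu').
Qed.

(* mu + e (mu' - mu), with e truncated to [0, 1]. *)
Definition mix phi (e : R) (mu mu' : Pphi phi) : Pphi phi :=
  mkPphi (mix_moment e mu mu').

Lemma cvg_Pphi phi (F : set_system (Pphi phi)) (mu : Pphi phi) : Filter F ->
  F --> mu <->
  ((fun la : Pphi phi => pairing la phi) @ F --> pairing mu phi) /\
  (forall f : E -> R, continuous f -> (exists M, forall x, `|f x| <= M) ->
    (fun la : Pphi phi => pairing la f) @ F --> pairing mu f).
Proof.
move=> FF; rewrite cvg_sup; split.
  move=> Fmu.
  have key (g : phi_test phi) :
      (fun la : Pphi phi => pairing la (proj1_sig g)) @ F -->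
      pairing mu (proj1_sig g).
    pose ev (la : finite_moment phi) := pairing la (proj1_sig g).
    exact: cvg_comp (Fmu g) (@initial_continuous _ _ ev mu).
  split; first exact: (key (exist _ (phi : E -> R) (or_introl erefl))).
  by move=> f cf bf; exact: (key (exist _ f (or_intror (conj cf bf)))).
move=> [Fphi Ff] [f hf] A [_ [[B oB <-] Bmu BA]]; apply: filterS BA _.
have nB : nbhs (pairing mu f) B by exact: open_nbhs_nbhs.
case: hf => [fphi|[cf bf]] in Bmu *; last exact: (Ff _ cf bf _ nB).
by subst f; exact: (Fphi _ nB).
Qed.
End Pphi.

Section relative_entropy.
Context d (T : measurableType d) (R : realType).
Local Open Scope ereal_scope.
Local Open Scope charge_scope.

Definition relative_entropy (mu nu : probability T R) : \bar R :=
  if `[< mu `<< nu >]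
  then \int[mu]_x lne (('d (charge_of_finite_measure mu) '/d nu) x)
  else +oo.
End relative_entropy.

Section large_deviations.
Context {R : realType} {X : ptopologicalType}.
Local Open Scope ereal_scope.

(* Index 0 is irrelevant, only limits in N being involved. *)
Definition ldp (Pi : nat -> probability (borel X) R) (J : X -> \bar R) : Prop :=
  [/\ lower_semicontinuous J,
      forall C : set X, closed C ->
        limn_esup (fun N => (N%:R^-1)%:E * lne (Pi N C)) <= - ereal_inf (J @` C)
    & forall U : set X, open U ->
        - ereal_inf (J @` U) <= limn_einf (fun N => (N%:R^-1)%:E * lne (Pi N U))].
End large_deviations.

Section conditional.
Context d (T : measurableType d) (R : realType).
Local Open Scope ereal_scope.

(* By convention, P itself if P A = 0; see [conditionalE]. *)
Definition conditional (P : probability T R) (A : set T) (mA : measurable A)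
    : probability T R :=
  mnormalize (mrestr P mA) P.

Lemma conditionalE (P : probability T R) (A : set T) (mA : measurable A) B :
  0 < P A -> conditional P mA B = P (B `&` A) / P A.
Proof.
move=> PA0; rewrite /conditional/= /mnormalize/= /mrestr setTI.
have PAfin : P A \is a fin_num by exact: fin_num_measure.
rewrite gt_eqF//= ifF; last by apply/negbTE; rewrite -ltey ltey_eq PAfin.
by rewrite -{2}(fineK PAfin) inver ifF// gt_eqF// fine_gt0// PA0 ltey_eq PAfin.
Qed.
End conditional.

Section constraints.
Context {R : realType} {E : completeMetricType R} {phi : weight E}.
Context {T : Type}.
Local Open Scope ereal_scope.

Definition feasible (Psi : T -> Pphi phi -> R) : set (Pphi phi) :=
  [set mu | forall t, (Psi t mu <= 0)%R].

Lemma closed_feasible (Psi : T -> Pphi phi -> R) :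
  (forall t, lower_semicontinuous (EFin \o Psi t)) -> closed (feasible Psi).
Proof.
move=> lPsi.
have -> : feasible Psi = \bigcap_t ~` [set mu | 0%:E < (EFin \o Psi t) mu].
  apply/seteqP; split=> mu h t.
    by move=> _ /=; rewrite lte_fin; apply/negP; rewrite -leNgt.
  by have /= := h t I; rewrite lte_fin => /negP; rewrite -leNgt.
apply: closed_bigI => t _; apply: open_closedC.
by move/lower_semicontinuousP : (lPsi t); exact.
Qed.

Lemma measurable_feasible (Psi : T -> Pphi phi -> R) :
  (forall t, lower_semicontinuous (EFin \o Psi t)) ->
  measurable (feasible Psi : set (borel (Pphi phi))).
Proof.
move=> /closed_feasible cA; rewrite -[feasible Psi]setCK.
by apply: measurableC; apply: sub_sigma_algebra; exact: closed_openC.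
Qed.
End constraints.

Section functionals.
Context {R : realType} {E : completeMetricType R} {phi : weight E}.
Variables (nu : probability (borel E) R) (F : Pphi phi -> \bar R).
Local Open Scope ereal_scope.

Definition calI (mu : Pphi phi) : \bar R := relative_entropy (law mu) nu + F mu.

Definition domI : set (Pphi phi) :=
  [set mu | relative_entropy (law mu) nu < +oo /\ F mu < +oo].

Variables (T : Type) (Psi : T -> Pphi phi -> R).

Definition infI : \bar R := ereal_inf (calI @` (domI `&` feasible Psi)).

Definition calI_cond (mu : Pphi phi) : \bar R :=
  if mu \in feasible Psi then calI mu - infI else +oo.
End functionals.

(* Main.v *)
(* The constraint set A = {sup_t Psi_t <= 0} is closed and contains the open set
   S = {sup_t Psi_t < 0}, so conditioning on A preserves the LDP as soon as
   inf_(U `&` S) I <= I on U `&` A for every open U. This follows by moving along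
   mu_e = mu + e (mu' - mu): mu_e -> mu, mu_e is in S for small e, and
   limsup I(mu_e) <= I(mu) by qualification (for F) and convexity of the
   relative entropy. The latter reduces to convexity of x ln x, thanks to
   H(mu|nu) + 1 = int (g ln g + 1) dnu, g = dmu/dnu, whose integrand is
   nonnegative. *)
Require Import Defs.
From mathcomp Require Import all_boot all_order all_algebra.
From mathcomp Require Import all_classical all_reals all_analysis.
From mathcomp Require Import measurable_realfun.
From mathcomp Require Import ring lra.

Set Implicit Arguments.
Unset Strict Implicit.
Unset Printing Implicit Defensive.

Import Order.TTheory GRing.Theory Num.Theory.
Import numFieldNormedType.Exports.

Local Open Scope classical_set_scope.
Local Open Scope ring_scope.

(** * Convexity of [x ln x] *)

Section xlnx.
Context {R : realType}.
Implicit Types a b t : R.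

(* Tangent line of [x ln x] at [b]; [ln 0 = 0] covers [a = 0]. *)
Lemma mulr_ln_tangent a b : 0 <= a -> 0 < b -> a * ln b + a - b <= a * ln a.
Proof.
rewrite le_eqVlt => /predU1P[<-|a0] b0.
  by rewrite !mul0r add0r sub0r oppr_le0 ltW.
have ab0 : 0 < b / a by rewrite divr_gt0.
have := @le_ln1Dx R (b / a - 1) _.
rewrite ltrBDr addNr => /(_ ab0); rewrite addrCA subrr addr0 ln_div ?posrE//.
rewrite -(ler_pM2l a0) mulrBr mulrBr mulr1 mulrCA divff ?gt_eqF// mulr1.
lra.
Qed.

Lemma mulr_ln_geN1 a : 0 <= a -> 0 <= a * ln a + 1.
Proof. by move=> a0; have := mulr_ln_tangent a0 ltr01; rewrite ln1; lra. Qed.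

(** The tangent at [c] bounds the function from below at [a] and at [b]; in the weighted average the
    linear terms cancel because [c] is the barycentre. *)
Lemma mulr_ln_convex t a b : 0 <= t <= 1 -> 0 <= a -> 0 <= b ->
  let c := (1 - t) * a + t * b in
  c * ln c <= (1 - t) * (a * ln a) + t * (b * ln b).
Proof.
move=> /andP[t0 t1] a0 b0 /=; set c := _ + _.
have t'0 : 0 <= 1 - t by rewrite subr_ge0.
have : 0 <= c by rewrite addr_ge0// mulr_ge0.
rewrite le_eqVlt => /predU1P[c0|c0].
  (* At [c = 0] there is no tangent, but then both weighted arguments vanish. *)
  rewrite -c0 mul0r !mulrA.
  have : c == 0 by rewrite -c0.
  rewrite /c paddr_eq0 ?mulr_ge0// => /andP[/eqP-> /eqP->].
  by rewrite !mul0r addr0.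
have := ler_wpM2l t'0 (mulr_ln_tangent a0 c0).
have := ler_wpM2l t0 (mulr_ln_tangent b0 c0).
have -> : c * ln c = (1 - t) * (a * ln c + a - c) + t * (b * ln c + b - c).
  by rewrite {1}/c /c; ring.
lra.
Qed.

End xlnx.

(** * Densities, and relative entropy as the integral of a nonnegative function *)

Section density.
Context d (T : measurableType d) (R : realType).
Variables (mu nu : probability T R).
Local Open Scope ereal_scope.
Local Open Scope charge_scope.

(** A version that is finite and nonnegative everywhere, so that inequalities on [x ln x] apply
    pointwise and mixtures of densities remain densities. *)
Definition is_density (g : T -> R) :=
  [/\ measurable_fun setT g, (forall x, (0 <= g x)%R) &
      forall A, measurable A -> mu A = \int[nu]_(x in A) (g x)%:E].

Lemma dominates_density : mu `<< nu -> exists g, is_density g.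
Proof.
move=> numu; pose f := Radon_Nikodym_SigmaFinite.f mu nu.
have fE x : (fine (f x))%:E = f x.
  by rewrite fineK//; exact: Radon_Nikodym_SigmaFinite.f_fin_num.
have mf := Radon_Nikodym_SigmaFinite.f_integrable numu.
exists (fine \o f); split.
- by apply/measurable_EFinP; rewrite (_ : _ \o _ = f);
    [exact: measurable_int mf|apply/funext => x; exact: fE].
- by move=> x; apply: fine_ge0; exact: Radon_Nikodym_SigmaFinite.f_ge0.
- move=> A mA; under eq_integral do rewrite fE.
  exact: Radon_Nikodym_SigmaFinite.f_integral.
Qed.

Variable g : T -> R.
Hypothesis gE : is_density g.

Let mg : measurable_fun setT (EFin \o g).
Proof. by case: gE => ? _ _; exact/measurable_EFinP. Qed.

Let g0 x : 0 <= (g x)%:E.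
Proof. by case: gE => _ + _; rewrite lee_fin. Qed.

Lemma density_dominates : mu `<< nu.
Proof.
case: gE => _ _ muE; apply/null_content_dominatesP => A mA nuA.
rewrite muE//; apply: null_set_integral => //.
exact: measurable_funTS.
Qed.

Lemma density_integrable : nu.-integrable setT (EFin \o g).
Proof.
case: gE => _ _ muE; apply/integrableP; split => //=.
under eq_integral => x _ do rewrite ger0_norm -?lee_fin//.
by rewrite -muE// probability_setT ltry.
Qed.

(** Two densities of [mu] agree [nu]-almost everywhere, so the change of variables known for one
    Radon-Nikodym derivative passes to [g]. *)
Lemma density_ge0_integral (h : T -> \bar R) : measurable_fun setT h ->
  (forall x, 0 <= h x) -> \int[mu]_x h x = \int[nu]_x (h x * (g x)%:E).
Proof.
move=> mh h0; have numu := density_dominates.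
rewrite -(Radon_Nikodym_SigmaFinite.change_of_variables numu)//.
have mf := Radon_Nikodym_SigmaFinite.f_integrable numu.
apply: ae_eq_integral => //.
- by apply: emeasurable_funM => //; exact: measurable_int mf.
- exact: emeasurable_funM.
- apply: ae_eqe_mul2l; apply: integral_ae_eq => // A _ mA.
  case: gE => _ _ <-//.
  by rewrite -Radon_Nikodym_SigmaFinite.f_integral.
Qed.

Lemma density_Radon_Nikodym :
  ae_eq nu setT ('d (charge_of_finite_measure mu) '/d nu) (EFin \o g).
Proof.
have numu := density_dominates.
apply: integral_ae_eq => //; first exact: Radon_Nikodym_integrable.
by move=> A _ mA; rewrite -Radon_Nikodym_integral//; case: gE => _ _ /= <-.
Qed.

Lemma density_null : mu [set x | g x = 0%R] = 0.
Proof.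
case: gE => mgR _ muE; rewrite muE.
  by rewrite integral0_eq// => x /= gx; rewrite gx.
by rewrite -[X in measurable X]setTI; exact: (mgR measurableT [set 0%R]).
Qed.

Lemma measurable_lne_EFin : measurable_fun setT (fun r : R => lne r%:E).
Proof.
apply: measurable_fun_ifT => //=; last first.
  by apply/measurable_EFinP; exact: measurable_ln.
exact: measurable_fun_ler.
Qed.

(** Since [g ln g >= -1], the negative part of [ln g] has [mu]-integral at most 1. It can therefore
    be subtracted, and the identity holds even for infinite entropy. *)
Lemma relative_entropy_density :
  relative_entropy mu nu + 1 = \int[nu]_x (g x * ln (g x) + 1)%:E.
Proof.
have numu := density_dominates.
have mgR : measurable_fun setT g by case: gE.
have mlng : measurable_fun setT (fun x => (ln (g x))%:E).
  by apply/measurable_EFinP; exact: measurableT_comp mgR.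
rewrite /relative_entropy asboolT//.
set h := 'd _ '/d _.
have hE x : h x = (fine (h x))%:E by rewrite fineK// Radon_Nikodym_fin_num.
have mh : measurable_fun setT h.
  by apply: measurable_int; exact: Radon_Nikodym_integrable.
(* [lne] is -oo at 0 whereas [ln 0 = 0]: the integrands agree off a [nu]-null set and off [g = 0],
   both of which are [mu]-null. *)
have -> : \int[mu]_x lne (h x) = \int[mu]_x (ln (g x))%:E.
  apply: ae_eq_integral => //.
    under eq_fun do rewrite hE.
    apply: (measurableT_comp measurable_lne_EFin).
    exact: measurableT_comp.
  have [N [mN nuN hN]] := density_Radon_Nikodym.
  have mZ : measurable [set x | g x = 0%R].
    by rewrite -[X in measurable X]setTI; exact: (mgR measurableT [set 0%R]).
  exists (N `|` [set x | g x = 0%R]); split; first exact: measurableU.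
    have muN : mu N = 0 by move/null_content_dominatesP : numu; exact.
    by rewrite measureU0//; exact: density_null.
  move=> x /= hx; apply: contrapT => /not_orP[Nx gx0]; apply: hx => _.
  have -> : h x = (g x)%:E.
    by apply: contrapT => hg; apply/Nx/hN => /(_ I).
  rewrite lne_EFin// lt_neqAle; case: gE => _ -> _; rewrite andbT.
  by apply/eqP => /esym.
rewrite integralE.
set f := fun x => (ln (g x))%:E.
have fp0 x : 0 <= f^\+ x * (g x)%:E by rewrite mule_ge0.
have fn0 x : 0 <= f^\- x * (g x)%:E by rewrite mule_ge0.
have mfp : measurable_fun setT (fun x => f^\+ x * (g x)%:E).
  by apply: emeasurable_funM => //; exact: measurable_funepos.
have mfn : measurable_fun setT (fun x => f^\- x * (g x)%:E).
  by apply: emeasurable_funM => //; exact: measurable_funeneg.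
have psi0 x : 0 <= (g x * ln (g x) + 1)%:E.
  by rewrite lee_fin mulr_ln_geN1// -lee_fin.
have mpsi : measurable_fun setT (fun x => (g x * ln (g x) + 1)%:E).
  apply/measurable_EFinP; apply: measurable_funD => //.
  by apply: measurable_funM => //; exact/measurable_EFinP.
rewrite (density_ge0_integral (measurable_funepos mlng))//.
rewrite (density_ge0_integral (measurable_funeneg mlng))//.
have int1 : \int[nu]_x 1 = 1 :> \bar R.
  by rewrite (integral_cst nu measurableT) mul1e; exact: probability_setT.
(* With the negative part moved across, all terms are nonnegative and their integrals add without
   any finiteness. *)
have fE x : f^\+ x * (g x)%:E + 1 = (g x * ln (g x) + 1)%:E + f^\- x * (g x)%:E.
  rewrite funeposE funenegE /f -EFinN -!EFin_max -!EFinM -!EFinD; congr EFin.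
  have [l0|l0] := leP 0%R (ln (g x)).
    by rewrite max_r ?oppr_le0//; ring.
  by rewrite max_l ?oppr_ge0 ?ltW//; ring.
have fn1 : \int[nu]_x (f^\- x * (g x)%:E) <= 1.
  rewrite -int1; apply: ge0_le_integral => // x _.
  rewrite funenegE /f -EFinN -!EFin_max -!EFinM lee_fin.
  have : (0 <= g x * ln (g x) + 1)%R by rewrite -lee_fin.
  have [l0|l0] := leP 0%R (- ln (g x))%R; last by rewrite mul0r.
  lra.
have fnfin : \int[nu]_x (f^\- x * (g x)%:E) \is a fin_num.
  by rewrite ge0_fin_numE ?integral_ge0// (le_lt_trans fn1)// ltry.
have := @ge0_integralD _ _ _ nu _ measurableT _ _ (fun x _ => fp0 x) mfp
  (fun x _ => lee01) (measurable_cst _).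
under eq_integral do rewrite fE.
rewrite ge0_integralD// int1 => PE.
by rewrite addeAC -PE addeK.
Qed.

End density.

(** * Mixtures of measures: entropy, pairings and convergence *)

Section mix.
Context {R : realType} {E : completeMetricType R}.
Implicit Types (e : R) (mu nu : probability (borel E) R) (phi : weight E).
Local Open Scope ereal_scope.

Lemma ge0_integral_mix e mu mu' (f : borel E -> \bar R) :
  measurable_fun setT f -> (forall x, 0 <= f x) ->
  \int[mix_measure e mu mu']_x f x =
  (1 - clamp e)%:E * \int[mu]_x f x + (clamp e)%:E * \int[mu']_x f x.
Proof.
move=> mf f0; rewrite /mix_measure ge0_integral_measure_add//.
by rewrite !ge0_integral_mscale.
Qed.

Lemma is_density_mix e mu mu' nu g g' :
  is_density mu nu g -> is_density mu' nu g' ->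
  is_density (mix_measure e mu mu') nu
    (fun x => (1 - clamp e) * g x + clamp e * g' x)%R.
Proof.
have c0 := clamp_ge0 e; have c1 := onem_clamp_ge0 e.
move=> [mg g0 gE] [mg' g'0 g'E]; split.
- by apply: measurable_funD; exact: measurable_funM.
- by move=> x; rewrite addr_ge0// mulr_ge0.
- move=> A mA; rewrite /= mix_measureE gE// g'E//.
  have mgA : measurable_fun A (EFin \o g).
    by apply/measurable_EFinP/measurable_funTS.
  have mgA' : measurable_fun A (EFin \o g').
    by apply/measurable_EFinP/measurable_funTS.
  under [RHS]eq_integral do rewrite EFinD !EFinM.
  rewrite ge0_integralD//.
  + by rewrite !ge0_integralZl// => x _; rewrite lee_fin.
  + by move=> x _; rewrite -EFinM lee_fin mulr_ge0.
  + exact: measurable_funeM.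
  + by move=> x _; rewrite -EFinM lee_fin mulr_ge0.
  + exact: measurable_funeM.
Qed.

(** Convexity of [x ln x] is integrated along the mixed density, which exists because finite entropy
    entails domination. The added constants 1 match since the weights sum to 1. *)
Lemma relative_entropy_mix e mu mu' nu :
  relative_entropy mu nu < +oo -> relative_entropy mu' nu < +oo ->
  relative_entropy (mix_measure e mu mu') nu <=
  (1 - clamp e)%:E * relative_entropy mu nu +
  (clamp e)%:E * relative_entropy mu' nu.
Proof.
have c0 := clamp_ge0 e; have c1 := onem_clamp_ge0 e.
have ac m : relative_entropy m nu < +oo -> exists g, is_density m nu g.
  by rewrite /relative_entropy; case: asboolP => // /dominates_density.
move=> Hmu Hmu'; have [g gE] := ac _ Hmu; have [g' gE'] := ac _ Hmu'.
have [mg g0 _] := gE; have [mg' g0' _] := gE'.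
have psi0 (h : borel E -> R) : (forall x, 0 <= h x)%R ->
    forall x, [set: borel E] x -> 0 <= (h x * ln (h x) + 1)%:E.
  by move=> h0 x _; rewrite lee_fin mulr_ln_geN1.
have mpsi (h : borel E -> R) : measurable_fun setT h ->
    measurable_fun [set: borel E] (fun x => (h x * ln (h x) + 1)%:E).
  move=> mh; apply/measurable_EFinP; apply: measurable_funD => //.
  by apply: measurable_funM => //; exact: (measurableT_comp (@measurable_ln R) mh).
have [mgc gc0 _] := is_density_mix e gE gE'.
have := relative_entropy_density (is_density_mix e gE gE').
have := relative_entropy_density gE; have := relative_entropy_density gE'.
set I' := integral _ _ _ => IE'; set I := integral _ _ _ => IE.
set J := integral _ _ _ => JE.
have JI : J <= (1 - clamp e)%:E * I + (clamp e)%:E * I'.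
  rewrite -!ge0_integralZl//; [|exact: mpsi|exact: psi0|exact: mpsi|exact: psi0].
  have Z (h : borel E -> R) c : (0 <= c)%R -> (forall x, 0 <= h x)%R ->
      forall x, [set: borel E] x -> 0 <= c%:E * (h x * ln (h x) + 1)%:E.
    by move=> ? h0 x xT; rewrite mule_ge0// psi0.
  have mZ (h : borel E -> R) c : measurable_fun setT h ->
      measurable_fun [set: borel E] (fun x => c%:E * (h x * ln (h x) + 1)%:E).
    by move=> mh; apply: measurable_funeM; exact: mpsi.
  rewrite -ge0_integralD//; [|exact: Z|exact: mZ|exact: Z|exact: mZ].
  apply: ge0_le_integral => //; first exact: psi0.
  - exact: mpsi.
  - by apply: emeasurable_funD; exact: mZ.
  - move=> x _; rewrite -!EFinM -EFinD lee_fin.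
    have e01 : (0 <= clamp e <= 1)%R by rewrite c0/= -subr_ge0.
    have := mulr_ln_convex e01 (g0 x) (g0' x) => /=; lra.
have I0 : 0 <= I by apply: integral_ge0; exact: psi0.
have I0' : 0 <= I' by apply: integral_ge0; exact: psi0.
rewrite -(@leeD2rE _ 1)// JE (le_trans JI)// -IE -IE'.
(* Nonnegativity of [I] and [I'] excludes the entropy value -oo. *)
move: Hmu Hmu' IE IE'.
case: (relative_entropy mu nu) => [r| |]//; last first.
  by move=> _ _ IN; rewrite -IN in I0.
case: (relative_entropy mu' nu) => [r'| |]//; last first.
  by move=> _ _ _ IN; rewrite -IN in I0'.
move=> _ _ _ _; rewrite -!(EFinD, EFinM) lee_fin; lra.
Qed.

(** Integrability keeps the positive and negative parts finite, so that [fine] commutes with the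
    sums. *)
Lemma pairing_mix phi e (mu mu' : Pphi phi) (f : E -> R) :
  (law mu).-integrable setT (EFin \o f) ->
  (law mu').-integrable setT (EFin \o f) ->
  pairing (mix e mu mu' : finite_moment phi) f =
  ((1 - clamp e) * pairing (mu : finite_moment phi) f
   + clamp e * pairing (mu' : finite_moment phi) f)%R.
Proof.
move=> fi fi'; have mf := measurable_int _ fi.
change (fine (\int[mix_measure e (law mu) (law mu')]_x (f x)%:E) =
  (1 - clamp e) * fine (\int[law mu]_x (f x)%:E) +
  clamp e * fine (\int[law mu']_x (f x)%:E))%R.
have mfp := measurable_funepos mf; have mfn := measurable_funeneg mf.
rewrite (integralE (mix_measure _ _ _)) (integralE (law mu)) (integralE (law mu')).
rewrite !ge0_integral_mix//.
have := integrable_pos_fin_num measurableT fi.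
have := integrable_neg_fin_num measurableT fi.
have := integrable_pos_fin_num measurableT fi'.
have := integrable_neg_fin_num measurableT fi'.
do 4 move=> /fineK <-.
rewrite -!(EFinN, EFinD, EFinM)/=; ring.
Qed.

Lemma weight_integrable phi (mu : Pphi phi) :
  (law mu).-integrable setT (EFin \o (phi : E -> R)).
Proof.
apply/integrableP; split; first exact: measurable_weight.
under eq_integral => x _ do rewrite /= ger0_norm ?weight_ge0//.
exact: (proj2_sig mu).
Qed.

Lemma bounded_continuous_integrable mu (f : E -> R) :
  continuous f -> (exists M, forall x, (`|f x| <= M)%R) ->
  mu.-integrable setT (EFin \o f).
Proof.
move=> cf [M fM]; apply: measurable_bounded_integrable => //.
- by rewrite (le_lt_trans (probability_le1 _ _))// ltry.
- exact: borel_continuous_measurable.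
- exists M; split; first exact: num_real.
  by move=> x Mx y _; exact: le_trans (fM y) (ltW Mx).
Qed.

Lemma cvg_clamp : clamp e @[e --> (0 : R)^'+] --> (0 : R)%R.
Proof.
apply: (squeeze_cvgr (f := fun=> 0%R) (h := fun e : R => e)).
- near=> e; rewrite clamp_ge0/= /clamp ge_max ge_min lexx/= andbT.
  by near: e; exact: nbhs_right_ge.
- exact: cvg_cst.
- exact: (cvg_at_right_filter cvg_id).
Unshelve. all: by end_near. Qed.

(** The topology is tested by [phi] and by bounded continuous functions. All are integrable, so
    their pairings are affine in [clamp e], which tends to 0. *)
Lemma cvg_mix phi (mu mu' : Pphi phi) :
  mix e mu mu' @[e --> (0 : R)^'+] --> mu.
Proof.
have key (f : E -> R) : (law mu).-integrable setT (EFin \o f) ->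
    (law mu').-integrable setT (EFin \o f) ->
    pairing (mix e mu mu' : finite_moment phi) f @[e --> (0 : R)^'+] -->
    pairing (mu : finite_moment phi) f.
  move=> fi fi'; set a := pairing (mu : finite_moment phi) f.
  set b := pairing (mu' : finite_moment phi) f.
  have -> : (fun e => pairing (mix e mu mu' : finite_moment phi) f) =
      (fun e => (1 - clamp e) * a + clamp e * b)%R.
    by apply/funext => e; exact: pairing_mix.
  suff : (fun e => (1 - clamp e) * a + clamp e * b)%R @ (0 : R)^'+ -->
      ((1 - 0) * a + 0 * b)%R by rewrite subr0 mul1r mul0r addr0.
  apply: cvgD; apply: cvgM; [|exact: cvg_cst|exact: cvg_clamp|exact: cvg_cst].
  by apply: cvgB; [exact: cvg_cst|exact: cvg_clamp].
apply/cvg_Pphi; split; first by apply: key; exact: weight_integrable.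
by move=> f cf bf; apply: key; exact: bounded_continuous_integrable.
Qed.

End mix.

(** * Upper limits along a filter *)

Section limf_esup.
Context {T : choiceType} {X : filteredType T} {R : realType}.
Variables (F : set_system X) (FF : Filter F).
Implicit Types (f g h : X -> \bar R) (a b : \bar R).
Local Open Scope ereal_scope.

Lemma limf_esup_lt_near f a : limf_esup f F < a -> \forall x \near F, f x < a.
Proof.
move=> /ereal_inf_lt[_ [A FA <-] supa]; apply: filterS FA => x Ax.
by apply: le_lt_trans supa; apply: ereal_sup_ubound; exists x.
Qed.

(** Together with [limf_esup_lt_near], this reduces estimates of upper limits to eventual bounds at
    real levels. *)
Lemma limf_esup_le_near f a :
  (forall r : R, a < r%:E -> \forall x \near F, f x <= r%:E) ->
  limf_esup f F <= a.
Proof.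
move=> fa; apply/lee_addgt0Pr => e e0; case: a fa => [r fr| |frNy].
- apply: ge_ereal_inf; exists (ereal_sup (f @` [set x | f x <= (r + e)%:E])).
    by exists [set x | f x <= (r + e)%:E] => //; apply: fr; rewrite lte_fin ltrDl.
  by apply: ge_ereal_sup => _ [x /= fx <-].
- by rewrite leey.
(* For [a = -oo] adding [e] gives no room; instead a real level strictly below the upper limit is
   refuted. *)
- rewrite leNgt; apply/negP => Nyf.
  have [r rf] : exists r : R, r%:E < limf_esup f F.
    move: Nyf; case: (limf_esup f F) => [s|_|//]; last by exists 0%R; rewrite ltry.
    by exists (s - 1)%R; rewrite lte_fin ltrBlDr ltrDl.
  move: rf; apply/negP; rewrite -leNgt; apply: ge_ereal_inf.
  exists (ereal_sup (f @` [set x | f x <= r%:E])).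
    by exists [set x | f x <= r%:E] => //; apply: frNy; exact: ltNyr.
  by apply: ge_ereal_sup => _ [x /= fx <-].
Qed.

Lemma limf_esup_le f g a : (\forall x \near F, f x <= g x) ->
  limf_esup g F <= a -> limf_esup f F <= a.
Proof.
move=> fg ga; apply: limf_esup_le_near => r ar.
have := limf_esup_lt_near (le_lt_trans ga ar).
by apply: filterS2 fg => x fx /ltW; exact: le_trans.
Qed.

(** Finiteness of [b] avoids opposite infinities in [a + b] and lets a level [r] be shared out: [r1]
    for [g] and [r - r1] for [h]. *)
Lemma limf_esup_leD f g h a b : b \is a fin_num ->
  (\forall x \near F, f x <= g x + h x) ->
  limf_esup g F <= a -> limf_esup h F <= b -> limf_esup f F <= a + b.
Proof.
move=> bfin fgh ga hb; apply: limf_esup_le_near => r.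
rewrite -lteBrDr// => abr.
have [r1 ar1 r1b] : exists2 r1 : R, a < r1%:E & (r1%:E < r%:E - b).
  move: bfin abr; case: b {fgh hb} => [b| |]// _; rewrite -EFinB.
  case: a {ga} => [a| |]//.
    by rewrite lte_fin => /midf_lt[? ?]; exists ((a + (r - b)) / 2)%R.
  by exists (r - b - 1)%R; rewrite ?ltNyr// lte_fin ltrBlDr ltrDl.
have bd : b < r%:E - r1%:E by rewrite lteBrDr// addeC -lteBrDr.
have := limf_esup_lt_near (le_lt_trans ga ar1).
have := limf_esup_lt_near (le_lt_trans hb bd).
move: fgh; apply: filterS3 => x fx hx gx; apply: (le_trans fx).
rewrite (le_trans (leeD (ltW gx) (ltW hx)))//.
by rewrite -EFinB -EFinD addrC subrK.
Qed.

End limf_esup.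

(** Upper semicontinuity of [f] on a compact space makes strict negativity uniform: [f <= - d] for
    some [d > 0], which survives the supremum. *)
Lemma sup_lt0_compact (R : realType) (T : topologicalType) (f : T -> R) :
  compact [set: T] -> lower_semicontinuous (fun t => (- f t)%:E) ->
  has_sup (range f) -> (forall t, f t < 0) -> sup (range f) < 0.
Proof.
move=> /compact_near_coveringP cT uf [f0 _] fN0.
have [d [d0 fd]] : exists d : R, 0 < d /\ forall t, f t <= - d.
  (* Near-covering compactness turns a bound for [s] near [t] and small [d] into one for all [s] at
     once; locally, [f t / 2] separates [f s] from [- d]. *)
  have : \forall d \near (0 : R)^'+, [set: T] `<=` [set t | f t <= - d].
    apply: cT => t _; have ft : ((- f t / 2)%:E < (- f t)%:E)%E.
      by rewrite lte_fin; have := fN0 t; lra.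
    have [V Vt Vf] := uf _ _ ft.
    exists (V, [set d | d <= - f t / 2]) => /=.
      split=> //; apply: nbhs_right_le; have := fN0 t; lra.
    by case=> s d /= [Vs dft]; have := Vf _ Vs; rewrite lte_fin; lra.
  move=> nd; near (0 : R)^'+ => d.
  have fd : [set: T] `<=` [set t | f t <= - d] by near: d.
  exists d; split; last by move=> t; exact: fd.
    by near: d; exact: nbhs_right_gt.
rewrite (@le_lt_trans _ _ (- d))// ?oppr_lt0//.
by apply: ge_sup => [//|_ [t _ <-]//].
Unshelve. all: by end_near. Qed.

(** * Conditioning a large deviation principle on a closed set *)

Section ldp_conditional.
Context {R : realType} {X : ptopologicalType}.
Variables (Pi : nat -> probability (borel X) R) (J : X -> \bar R).
Hypothesis Pi_ldp : ldp Pi J.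
Local Open Scope ereal_scope.

(** The whole space is open and has probability 1, so the lower bound there reads [- inf J <= 0]. *)
Lemma ldp_rate_ge0 x : 0 <= J x.
Proof.
have [_ _ /(_ _ openT)] := Pi_ldp.
rewrite (_ : (fun N => _) = cst 0); last first.
  by apply/funext => N; rewrite [Pi N _]probability_setT lne1 mule0.
have [-> _] := @cvg_limn_einf_sup R (cst 0) 0 (cvg_cst _).
rewrite oppe_le0 => /le_trans; apply; apply: ereal_inf_lbound.
by exists x.
Qed.

Variables (A S : set X) (mA : measurable (A : set (borel X))).
Hypotheses (cA : closed A) (oS : open S) (SA : S `<=` A).
Hypothesis PiA : forall N, (0 < N)%N -> 0 < Pi N A.
Hypothesis JA : ereal_inf (J @` A) < +oo.
(** The part of [U] in [A] need not be open, so the lower bound may not apply to it; this density of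
    [S] in [A], measured by [J], allows the part of [U] in [S] to replace it. *)
Hypothesis JS : forall (U : set X) x, open U -> U x -> A x -> J x < +oo ->
  ereal_inf (J @` (U `&` S)) <= J x.

Let m := ereal_inf (J @` A).
Let u (B : set X) N := (N%:R^-1)%:E * lne (Pi N B).
Let Jc x := if x \in A then J x - m else +oo.

Let m_fin : m \is a fin_num.
Proof.
rewrite ge0_fin_numE//; apply: le_ereal_inf_tmp => _ [x _ <-].
exact: ldp_rate_ge0.
Qed.

Let JSA (U : set X) : open U ->
  ereal_inf (J @` (U `&` S)) <= ereal_inf (J @` (U `&` A)).
Proof.
move=> oU; apply: le_ereal_inf_tmp => _ [x [Ux Ax] <-].
by have [->|Jx] := eqVneq (J x) +oo; [rewrite leey|apply: JS => //; rewrite ltey].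
Qed.

Let le_u (B C : set X) N : measurable (B : set (borel X)) ->
  measurable (C : set (borel X)) -> B `<=` C -> u B N <= u C N.
Proof.
move=> mB mC BC; apply: lee_wpmul2l; first by rewrite lee_fin invr_ge0.
by rewrite lee_lne ?in_itv/= ?leey ?measure_ge0// le_measure// inE.
Qed.

Let lne_PiA N : (0 < N)%N -> lne (Pi N A) \is a fin_num.
Proof.
move=> /PiA; have : Pi N A \is a fin_num by exact: fin_num_measure.
by case: (Pi N A) => // p _ p0; rewrite lne_EFin.
Qed.

Let uA_fin N : (0 < N)%N -> u A N \is a fin_num.
Proof. by move=> N0; rewrite fin_numM// lne_PiA. Qed.

Let u_conditional N (B : set X) : (0 < N)%N -> measurable (B : set (borel X)) ->
  (N%:R^-1)%:E * lne (conditional (Pi N) mA B) = u (B `&` A) N - u A N.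
Proof.
move=> N0 mB; rewrite conditionalE ?PiA//.
have N0' : 0 < (N%:R^-1)%:E :> \bar R by rewrite lte_fin invr_gt0 ltr0n.
have uA := uA_fin N0.
(* If [B] meets [A] in a null event, both sides are -oo, [u A N] being finite; otherwise the
   logarithm of the quotient splits. *)
have [BA0|BA0] := eqVneq (Pi N (B `&` A)) 0.
  by rewrite /u BA0 mul0e le0_lneNy// gt0_muleNy// addNye.
rewrite lne_div ?in_itv/= ?leey ?andbT ?PiA// ?lt0e ?BA0 ?measure_ge0//.
by rewrite muleBr// fin_num_adde_defl// fin_numN lne_PiA.
Qed.

Let measurable_open (B : set X) : open B -> measurable (B : set (borel X)).
Proof. by move=> oB; exact: sub_sigma_algebra. Qed.

Let measurable_closed (B : set X) : closed B -> measurable (B : set (borel X)).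
Proof.
move=> cB; rewrite -[B]setCK; apply: measurableC; apply: measurable_open.
exact: closed_openC.
Qed.

Let near_pos : \forall N \near \oo, (0 < N)%N.
Proof. by exists 1%N. Qed.

(** The logarithm of a conditional probability is a difference, so each bound pairs one side of the
    given principle for the numerator with the opposite side for the normalisation. *)
Lemma ldp_conditional : ldp (fun N => conditional (Pi N) mA) Jc.
Proof.
have [lscJ upper lower] := Pi_ldp; split.
(* On [A] the level [a + m] is used for [J]; off [A], the open complement carries the value +oo. *)
- move=> x a; rewrite /Jc; case: ifPn => [|/negP] xA.
    rewrite lteBrDr// => aJ; move: m_fin aJ (lscJ x).
    case: (m) => [r| |]// _; rewrite -EFinD => /[swap] /[apply] -[V xV VJ].
    exists V => // y /VJ; case: ifPn => _; last by rewrite ltry.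
    by rewrite EFinD lteBrDr.
  exists (~` A).
    by apply: open_nbhs_nbhs; split; [exact: closed_openC|rewrite inE in xA].
  by move=> y Ay; rewrite ifN ?ltry//; apply/negP; rewrite inE.
- move=> C cC; rewrite (@le_trans _ _ (- ereal_inf (J @` (C `&` A)) + m))//.
    apply: (@limf_esup_leD _ _ _ _ _ _ (u (C `&` A)) (fun N => - u A N)) => //.
    + apply: filterS near_pos => N N0.
      by rewrite u_conditional//; exact: measurable_closed.
    + by apply: upper; exact: closedI.
    (* [Pi N A] is bounded below through the open [S], where the infimum of [J] is at most [m]. *)
    + apply: (@limf_esup_le _ _ _ _ _ _ (fun N => - u S N)).
        by apply: nearW => N; rewrite leeN2 le_u//; exact: measurable_open.
      have := lower _ oS; rewrite /limn_einf leeN2 => /le_trans; apply.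
      by have := JSA openT; rewrite !setTI.
  rewrite leeNr oppeD ?fin_num_adde_defl// oppeK.
  rewrite leeBrDr//; apply: le_ereal_inf_tmp => _ [x [Cx Ax] <-].
  rewrite -leeBrDr//; apply: ereal_inf_lbound; exists x => //.
  by rewrite /Jc mem_set.
(* A lower limit is minus the upper limit of the negated sequence, so the same subadditivity
   applies. *)
- move=> U oU; rewrite /limn_einf leeN2.
  rewrite (@le_trans _ _ (ereal_inf (J @` (U `&` A)) - m))//.
    apply: (@limf_esup_leD _ _ _ _ _ _ (fun N => - u (U `&` S) N) (u A)) => //.
    + by rewrite fin_numN.
    + apply: filterS near_pos => N N0.
      rewrite u_conditional//; last exact: measurable_open.
      rewrite fin_num_oppeB ?uA_fin// leeD2r// leeN2 le_u//.
      * by apply: measurable_open; exact: openI.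
      * by apply: measurableI => //; exact: measurable_open.
      * by apply: setIS.
    + rewrite (le_trans _ (JSA oU))//.
      by have := lower _ (openI oU oS); rewrite /limn_einf leeN2.
    + exact: upper.
  apply: le_ereal_inf_tmp => _ [x Ux <-]; rewrite /Jc.
  case: ifPn => [|_]; last by rewrite leey.
  by rewrite inE => Ax; rewrite leeB// ereal_inf_lbound//; exists x.
Qed.

Lemma conditional_rate_ge0 x : 0 <= Jc x.
Proof.
rewrite /Jc; case: ifPn => [|_]; last by rewrite leey.
by rewrite inE => Ax; rewrite sube_ge0 ?m_fin// ereal_inf_lbound//; exists x.
Qed.

End ldp_conditional.

(** * The entropic rate function under inequality constraints *)

Theorem theorem2p7 (R : realType) (E : completeMetricType R)
    (sepE : separable E) (phi : weight E) (nu : probability (borel E) R)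
    (F : Pphi phi -> \bar R)
    (F_gtNy : forall mu, (-oo < F mu)%E)
    (mF : measurable_fun [set: borel (Pphi phi)] (F : borel (Pphi phi) -> \bar R))
    (T : metricType R) (compactT : compact [set: T])
    (Psi : T -> Pphi phi -> R)
    (Psi_usc : forall mu, lower_semicontinuous (fun t : T => (- Psi t mu)%:E))
    (exp_moment : forall alpha : R, 0 < alpha ->
      (\int[nu]_x (expR (alpha * phi x))%:E < +oo)%E)
    (I_lsc : lower_semicontinuous (calI nu F))
    (Psi_lsc : forall t, lower_semicontinuous (EFin \o Psi t))
    (sup_Psi : forall mu, has_sup [set Psi t mu | t in [set: T]])
    (sup_Psi_continuous :
      continuous (fun mu : Pphi phi => sup [set Psi t mu | t in [set: T]]))
    (qualification : forall mu, (domI nu F `&` feasible Psi) mu ->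
      exists mu', [/\ domI nu F mu',
        \forall e \near (0 : R)^'+, forall t, Psi t (mix e mu mu') < 0 &
        (limf_esup (fun e : R => F (mix e mu mu')) (0 : R)^'+ <= F mu)%E])
    (infI_lty : (infI nu F Psi < +oo)%E)
    (Pi : nat -> probability (borel (Pphi phi)) R)
    (Pi_ldp : ldp Pi (calI nu F))
    (Pi_feasible : forall N, (0 < N)%N -> (0 < Pi N (feasible Psi))%E) :
  ldp (fun N => conditional (Pi N) (measurable_feasible Psi_lsc))
      (calI_cond nu F Psi) /\
  forall mu, (0 <= calI_cond nu F Psi mu)%E.
Proof.
pose A := feasible Psi; pose I := calI nu F.
pose s mu := sup [set Psi t mu | t in [set: T]].
pose S := [set mu : Pphi phi | s mu < 0].
have cA : closed A by exact: closed_feasible.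
have oS : open S.
  rewrite (_ : S = s @^-1` [set x | x < 0])//.
  apply: open_comp; last exact: open_lt.
  by move=> mu _; exact: sup_Psi_continuous.
have SA : S `<=` A.
  move=> mu smu t; apply: le_trans (ltW smu).
  by apply: ub_le_sup; [exact: (sup_Psi mu).2|exists t].
have I0 mu : (0 <= I mu)%E by exact: ldp_rate_ge0 Pi_ldp mu.
(* An entropy of -oo would force [I mu = -oo], against [I0]. *)
have H_fin mu : domI nu F mu -> relative_entropy (law mu) nu \is a fin_num.
  move=> [H _]; have := I0 mu; rewrite /I /calI; move: H.
  by case: relative_entropy.
have F_fin mu : domI nu F mu -> F mu \is a fin_num.
  by move=> [_]; have := F_gtNy mu; case: (F mu).
(* With -oo excluded for both terms, a sum below +oo forces each term below +oo. *)
have dom_lty mu : (I mu < +oo)%E -> domI nu F mu.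
  rewrite /domI /= => Imu; have := I0 mu; move: Imu (F_gtNy mu); rewrite /I /calI.
  by case: relative_entropy => [h| |]; case: (F mu) => [f| |]//=; rewrite ?ltry.
(* Points of [A] outside the domain have [I = +oo], so dropping the domain leaves the infimum
   unchanged. *)
have infIE : infI nu F Psi = ereal_inf (I @` A).
  apply/eqP; rewrite eq_le; apply/andP; split.
    apply: le_ereal_inf_tmp => _ [mu Amu <-].
    have [->|Imu] := eqVneq (I mu) +oo%E; first by rewrite leey.
    apply: ereal_inf_lbound; exists mu => //; split=> //.
    by apply: dom_lty; rewrite ltey.
  apply: ereal_inf_le_tmp => _ [mu [_ Amu] <-].
  by exists mu.
have JS (U : set (Pphi phi)) mu : open U -> U mu -> A mu -> (I mu < +oo)%E ->
    (ereal_inf (I @` (U `&` S)) <= I mu)%E.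
  move=> oU Umu Amu /dom_lty Dmu.
  have [mu' [Dmu' PsiN limF]] := qualification _ (conj Dmu Amu).
  (* The margin [d] is halved: one half for the upper limit of [F], the other for
     [clamp e * (h' - h)], the entropy excess allowed by convexity. *)
  apply/lee_addgt0Pr => d d0.
  have [h hE] : exists h, relative_entropy (law mu) nu = h%:E.
    by exists (fine (relative_entropy (law mu) nu)); rewrite fineK// H_fin.
  have [h' h'E] : exists h, relative_entropy (law mu') nu = h%:E.
    by exists (fine (relative_entropy (law mu') nu)); rewrite fineK// H_fin.
  have [f fE] : exists f, F mu = f%:E.
    by exists (fine (F mu)); rewrite fineK// F_fin.
  rewrite fE in limF.
  have Fd : \forall e \near (0 : R)^'+, (F (mix e mu mu') < (f + d / 2)%:E)%E.
    apply: limf_esup_lt_near; apply: le_lt_trans limF _.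
    by rewrite lte_fin ltrDl divr_gt0.
  have cd : \forall e \near (0 : R)^'+, clamp e * (h' - h) < d / 2.
    have : clamp e * (h' - h) @[e --> (0 : R)^'+] --> 0 * (h' - h).
      by apply: cvgM; [exact: cvg_clamp|exact: cvg_cst].
    by rewrite mul0r => /cvgr_lt; apply; rewrite divr_gt0.
  have Ue : \forall e \near (0 : R)^'+, U (mix e mu mu').
    have /(_ U) := @cvg_mix _ _ phi mu mu'; apply; exact: open_nbhs_nbhs.
  near (0 : R)^'+ => e.
  apply: (@le_trans _ _ (I (mix e mu mu'))).
    apply: ereal_inf_lbound; exists (mix e mu mu') => //; split; first by near: e.
    (* Qualification is strict only for each [t]; compactness of [T] carries it to the supremum,
       placing the mixture in [S]. *)
    apply: sup_lt0_compact => //; near: e; exact: PsiN.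
  have := @relative_entropy_mix _ _ e (law mu) (law mu') nu.
  rewrite hE h'E => /(_ (ltry _) (ltry _)) Hle.
  rewrite /I /calI hE fE; apply: (@le_trans _ _
    ((1 - clamp e)%:E * h%:E + (clamp e)%:E * h'%:E + (f + d / 2)%:E)%E).
    by apply: leeD => //; apply: ltW; near: e.
  have : clamp e * (h' - h) < d / 2 by near: e.
  by rewrite -!(EFinD, EFinM) lee_fin => ?; lra.
have cE : calI_cond nu F Psi =
    fun mu => (if mu \in A then I mu - ereal_inf (I @` A) else +oo)%E.
  by apply/funext => mu; rewrite /calI_cond infIE.
rewrite cE; rewrite infIE in infI_lty; split.
  exact: ldp_conditional cA oS SA Pi_feasible infI_lty JS.
move=> mu; exact: (conditional_rate_ge0 Pi_ldp infI_lty).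
Unshelve. all: by end_near. Qed.
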